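(* Let $\mathcal{X}\subset\mathbb{R}^d$ be a compact metric space, $\mathcal{Y}\subset\mathbb{R}$, and let $\rho$ be a probability measure on $\mathcal{X}\times\mathcal{Y}$ with marginal $\rho_{\mathcal{X}}$. Let $f^\star(x)=\mathbb{E}(Y\mid X=x)$ be bounded, let $\mathcal{H}$ be a compact, uniformly bounded subset of $C(\mathcal{X})$, and set $M=\max\{\|f^\star\|_\infty,\sup_{f\in\mathcal{H}}\|f\|_\infty\}$. Assume: (i) there is $\epsilon>0$ with $\mathbb{E}|Y|^{1+\epsilon}<+\infty$; (ii) there exist positive constants $q,c$ with $\log\mathcal{N}(\mathcal{H},\eta)\le c\,\eta^{-q}$ for all $\eta>0$. Let $\sigma>\max\{2M,1\}$, let $\mathbf{z}=\{(x_i,y_i)\}_{i=1}^n$ be i.i.d. draws from $\rho$, and let \[ f_{\mathbf{z},\sigma}=\arg\min_{f\in\mathcal{H}}\frac1n\sum_{i=1}^n\ell_\sigma(y_i-f(x_i)). \] Then for any $0<\delta<1$, with probability at least $1-\delta$, \[ \|f_{\mathbf{z},\sigma}-f^\star\|_{2,\rho}^2\lesssim \|f_{\mathcal{H}}-f^\star\|_{2,\rho}^2+\log(2/\delta)\,\Psi(n,\epsilon,\sigma), \] where \[ \Psi(n,\epsilon,\sigma)=\begin{cases}\dfrac{1}{\sigma^\epsilon}+\dfrac{\sigma}{n^{1/(q+1)}}, & 0<\epsilon\le1,\\[1ex] \dfrac{1}{\sigma^\epsilon}+\Big(\dfrac{\sigma^{q+\frac{2\epsilon}{1+\epsilon}}}{n}\Big)^{1/(q+1)},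 & \epsilon>1.\end{cases} \]
   Context: The Huber loss with scale parameter $\sigma>0$ is $\ell_\sigma(t)=t^2$ if $|t|\le\sigma$ and $\ell_\sigma(t)=2\sigma|t|-\sigma^2$ otherwise. $\|g\|_{2,\rho}$ is the $L^2(\rho_{\mathcal{X}})$ norm. $f_{\mathcal{H}}=\arg\min_{f\in\mathcal{H}}\|f-f^\star\|_{2,\rho}^2$. For $\eta>0$, $\mathcal{N}(\mathcal{H},\eta)$ is the minimal $k$ such that there exist $f_1,\dots,f_k\in\mathcal{H}$ with $\mathcal{H}\subset\bigcup_{j=1}^k\{f\in C(\mathcal{X}):\|f-f_j\|_\infty<\eta\}$. The notation $a\lesssim b$ means $a\le Cb$ for a positive constant $C$ independent of $n$, $\delta$ and $\sigma$. *)

(* Defs.v *)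
From HB Require Import structures.
From mathcomp Require Import all_boot all_order all_algebra.
From mathcomp Require Import all_classical all_reals all_analysis.
Set Implicit Arguments. Unset Strict Implicit. Unset Printing Implicit Defensive.
Import Order.TTheory GRing.Theory Num.Theory.
Import numFieldNormedType.Exports.
Local Open Scope classical_set_scope.
Local Open Scope ring_scope.

Definition Rd (R : realType) (d : nat) :=
  g_sigma_algebraType (@open 'rV[R]_d).

Definition huber (R : realType) (sigma t : R) : R :=
  if `|t| <= sigma then t ^+ 2 else 2 * sigma * `|t| - sigma ^+ 2.

Definition supnormX (R : realType) (d : nat) (X : set 'rV[R]_d) (f : 'rV[R]_d -> R) : R :=
  sup [set `|f x| | x in X].

Definition has_cover (R : realType) (d : nat) (X : set 'rV[R]_d)
  (H : set ('rV[R]_d -> R)) (eta : R) (k : nat) : Prop :=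
  exists fs : 'I_k -> ('rV[R]_d -> R),
    (forall i, H (fs i)) /\
    H `<=` \bigcup_(i in [set: 'I_k]) [set f | supnormX X (f \- fs i) < eta].

Definition covering_number (R : realType) (d : nat) (X : set 'rV[R]_d)
  (H : set ('rV[R]_d -> R)) (eta : R) : nat :=
  match pselect (exists k, `[< has_cover X H eta k >]) with
  | left P => ex_minn P
  | right _ => 0%N
  end.

Definition L2sq (R : realType) (d : nat) (X : set 'rV[R]_d)
  (rho : probability (Rd R d * R)%type R) (g : 'rV[R]_d -> R) : \bar R :=
  (\int[rho]_(z in (X : set (Rd R d)) `*` [set: R]) ((g z.1) ^+ 2)%:E)%E.

Definition cond_exp (R : realType) (d : nat)
  (rho : probability (Rd R d * R)%type R) (fstar : 'rV[R]_d -> R) : Prop :=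
  forall A : set (Rd R d), measurable A ->
    (\int[rho]_(z in A `*` [set: R]) (z.2)%:E =
     \int[rho]_(z in A `*` [set: R]) (fstar z.1)%:E)%E.

Definition iid_sample (R : realType) (d : nat) (rho : probability (Rd R d * R)%type R)
  (n : nat) (dO : measure_display) (Omega : measurableType dO)
  (P : probability Omega R) (Zs : 'I_n -> Omega -> (Rd R d * R)%type) : Prop :=
  (forall i, measurable_fun setT (Zs i)) /\
  (forall i (A : set (Rd R d * R)%type), measurable A -> P (Zs i @^-1` A) = rho A) /\
  (forall A : 'I_n -> set (Rd R d * R)%type, (forall i, measurable (A i)) ->
     fine (P (\bigcap_(i in [set: 'I_n]) (Zs i @^-1` A i)))
     = \prod_(i < n) fine (P (Zs i @^-1` A i))).

Definition emp_risk (R : realType) (d : nat) (n : nat) (sigma : R)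
  (z : 'I_n -> (Rd R d * R)%type) (f : 'rV[R]_d -> R) : R :=
  n%:R^-1 * \sum_(i < n) huber sigma ((z i).2 - f (z i).1).

Definition Psi (R : realType) (n : nat) (eps q sigma : R) : R :=
  if eps <= 1 then sigma `^ (- eps) + sigma / (n%:R `^ (1 / (q + 1)))
  else sigma `^ (- eps) + (sigma `^ (q + 2 * eps / (1 + eps)) / n%:R) `^ (1 / (q + 1)).

(* Main.v *)
(** Write V for [variance_scale eps sigma], g for the second summand of Psi and
D(f) for the squared distance to fstar. The Huber and square losses of
y - f(x) differ only when |y| > sigma / 2, so the excess Huber risk of f is
D(f) up to a bias of order sigma^-eps; truncating |y| bounds the second moment
of the excess loss by V (D(f) + D(fH) + sigma^-eps). Hence, for a small
multiple u of the loss of fH minus the loss of f (factor 1 / (16 (1 + M) V)),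
the bound e^u <= 1 + u + u^2 makes the log-moment of u linear in the risks: at most
(- D(f) / 2 + 3 D(fH) / 2 + O(sigma^-eps)) / (16 (1 + M) V). Chernoff's bound
over a net of H of radius g / sigma costs (ln N + ln (1 / delta)) V / n, which is
at most (c + ln (2 / delta)) g because V / n * (sigma / g)^q = g. When
g > sigma the claim is trivial since D <= 4 M^2. *)

Require Import Defs.
From HB Require Import structures.
From mathcomp Require Import all_boot all_order all_algebra.
From mathcomp Require Import all_classical all_reals all_analysis.
From mathcomp Require Import measurable_realfun measurable_fun_approximation.
From mathcomp Require Import lra ring.
Import Order.TTheory GRing.Theory Num.Theory.
Import numFieldNormedType.Exports.
Local Open Scope classical_set_scope.
Local Open Scope ring_scope.

Set Implicit Arguments.
Unset Strict Implicit.

(** * The Huber loss *)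

(** The loss is even with slope 2 min(|t|, sigma), so its slope on [-w, w] is at most 2 min(sigma,
    w). The cap at sigma controls the range of the loss, the truncated w its second moment. *)
Lemma huber_lipschitz (R : realType) (sigma w a b : R) :
  0 <= sigma -> `|a| <= w -> `|b| <= w ->
  `|huber sigma a - huber sigma b| <= 2 * Num.min sigma w * `|a - b|.
Proof.
move=> s0; wlog ab : a b / `|a| <= `|b|.
  move=> H aw bw; case: (leP `|a| `|b|) => [/H|/ltW/H]; first exact.
  by rewrite distrC [`|b - a|]distrC; apply.
move=> aw bw; have w0 : 0 <= w by apply: le_trans aw.
have dab : `|b| - `|a| <= `|a - b| by rewrite distrC lerB_dist.
have m0 : 0 <= Num.min sigma w by rewrite le_min s0.
apply: le_trans (_ : 2 * Num.min sigma w * (`|b| - `|a|) <= _); last first.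
  by rewrite ler_wpM2l ?mulr_ge0.
have a0 := normr_ge0 a.
rewrite distrC -[huber sigma b]/(if _ then _ else _) -[huber sigma a]/(if _ then _ else _).
rewrite -(real_normK (num_real a)) -(real_normK (num_real b)).
rewrite minEle.
case: ifP => hb; case: ifP => ha; case: ifP => hw; rewrite ler_norml; nra.
Qed.

(** If |y| <= sigma / 2, both residuals stay below sigma and both losses are quadratic. Otherwise
    t^2 minus the Huber loss is (|t| - sigma)_+^2; its slope between the two residuals is at most 2
    |y| because M < sigma, and the residuals differ by at most 2 M. *)
Lemma huber_sqr_defect (R : realType) (sigma M y f g : R) :
  2 * M < sigma -> `|f| <= M -> `|g| <= M ->
  `|huber sigma (y - f) - huber sigma (y - g) - ((y - f) ^+ 2 - (y - g) ^+ 2)|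
  <= if `|y| <= sigma / 2 then 0 else 4 * M * `|y|.
Proof.
move=> sM fM gM; have M0 : 0 <= M by apply: le_trans fM.
have f0 := normr_ge0 f; have g0 := normr_ge0 g.
have af : `|y - f| <= `|y| + M by apply: le_trans (ler_normB _ _) _; lra.
have ag : `|y - g| <= `|y| + M by apply: le_trans (ler_normB _ _) _; lra.
have dfg : `| `|y - f| - `|y - g| | <= 2 * M.
  apply: le_trans (ler_dist_dist _ _) _.
  rewrite (_ : _ - _ - _ = g - f); last by ring.
  by apply: le_trans (ler_normB _ _) _; lra.
rewrite /huber -(real_normK (num_real (y - f))) -(real_normK (num_real (y - g))).
case: (boolP (`|y| <= sigma / 2)) => hy.
  by rewrite !ifT ?subrr ?normr0 //; lra.
move: dfg; rewrite -ltNge in hy; rewrite ler_norml => /andP[d1 d2].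
case: ifPn => hf; case: ifPn => hg; rewrite ?ler_norml; nra.
Qed.

(* Up to constants, the second moment of the excess loss is at most this scale
   times the excess risk plus sigma^-eps. For 1 < eps it is the square of the level
   sigma^(eps / (1 + eps)) at which |y| + M is truncated. *)
Definition variance_scale (R : realType) (eps sigma : R) : R :=
  if eps <= 1 then sigma else sigma `^ (2 * eps / (1 + eps)).

Lemma le_variance_scale (R : realType) (eps sigma : R) :
  1 <= sigma -> sigma <= variance_scale eps sigma.
Proof.
move=> s1; rewrite /variance_scale; case: (leP eps 1) => // e1.
by apply: le1r_powR => //; rewrite ler_pdivlMr; lra.
Qed.

(** Markov's inequality in pointwise form: where the defect is nonzero, 1 <= (|y| / (sigma /
    2))^eps, which turns |y| into a multiple of sigma^-eps |y|^(1 + eps). *)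
Lemma huber_bias (R : realType) (eps sigma M y f g : R) :
  0 < eps -> 2 * M < sigma -> 1 < sigma -> `|f| <= M -> `|g| <= M ->
  `|huber sigma (y - f) - huber sigma (y - g) - ((y - f) ^+ 2 - (y - g) ^+ 2)|
  <= 4 * M * 2 `^ eps * sigma `^ (- eps) * (`|y| + M) `^ (1 + eps).
Proof.
move=> e0 sM s1 fM gM; have M0 : 0 <= M by apply: le_trans fM.
apply: le_trans (huber_sqr_defect y sM fM gM) _; case: ifPn => [_|].
  by rewrite !mulr_ge0 // ?powR_ge0.
rewrite -ltNge => hy; rewrite -!mulrA !ler_wpM2l // mulrA.
have y0 : 0 < `|y| by apply: lt_trans hy; lra.
have s0 : 0 < sigma by lra.
have -> : 2 `^ eps * sigma `^ (- eps) = (sigma / 2) `^ (- eps).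
  rewrite powRM // ?invr_ge0 // ?ltW // mulrC; congr (_ * _).
  by rewrite -[2^-1]powR_inv1 // -powRrM mulN1r opprK.
rewrite powRN ler_pdivlMl ?powR_gt0 //; last by lra.
apply: le_trans (_ : `|y| `^ (1 + eps) <= _); last first.
  by apply: ge0_ler_powR; rewrite ?nnegrE //; lra.
rewrite addrC powRD; last by apply/implyP => _; lra.
rewrite powRr1 // ler_wpM2r //.
by apply: ge0_ler_powR; rewrite ?nnegrE //; lra.
Qed.

(** Used with D = (f - h)^2, m = 4 M^2 and w = |y| + M. For eps <= 1, split min^2 = min^(1 - eps)
    min^(1 + eps) and bound the factors by powers of sigma and of w. *)
Lemma sqr_le_truncated_moment (R : realType) (eps sigma w D m : R) :
  0 < eps -> 1 < sigma -> 0 <= w -> 0 <= D <= m ->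
  D * Num.min sigma w ^+ 2 <=
  variance_scale eps sigma * (D + m * sigma `^ (- eps) * w `^ (1 + eps)).
Proof.
move=> e0 s1 w0 /andP[D0 Dm]; rewrite /variance_scale.
have s0 : 0 < sigma by lra.
have min0 : 0 <= Num.min sigma w by rewrite le_min w0 ltW.
have minw : Num.min sigma w <= w by rewrite ge_min lexx orbT.
have mins : Num.min sigma w <= sigma by rewrite ge_min lexx.
have pw := powR_ge0 w (1 + eps); have ps := powR_ge0 sigma (- eps).
have m0 : 0 <= m by lra.
case: (leP eps 1) => e1.
  apply: le_trans (_ : sigma * (m * sigma `^ (- eps) * w `^ (1 + eps)) <= _); last first.
    by rewrite ler_wpM2l ?(ltW s0) // lerDr.
  have -> : sigma * (m * sigma `^ (- eps) * w `^ (1 + eps)) =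
      m * (sigma `^ (1 - eps) * w `^ (1 + eps)).
    rewrite [sigma `^ (1 - eps)]powRD ?(gt_eqF s0) ?implybT //.
    by rewrite powRr1 ?(ltW s0) //; ring.
  apply: ler_pM => //; first exact: sqr_ge0.
  have -> : Num.min sigma w ^+ 2 =
      Num.min sigma w `^ (1 - eps) * Num.min sigma w `^ (1 + eps).
    rewrite -powRD; last by apply/implyP => /eqP; lra.
    by rewrite -powR_mulrn //; congr (_ `^ _); ring.
  apply: ler_pM; rewrite ?powR_ge0 //; apply: ge0_ler_powR;
    by rewrite ?nnegrE ?(ltW s0) //; lra.
(* For eps > 1 the level T satisfies T^-(1 + eps) = sigma^-eps. Below T the square is at most T^2;
   above T, w^2 <= T^2 (w / T)^(1 + eps), which is paid by the moment term. *)
set T := sigma `^ (eps / (1 + eps)).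
have T0 : 0 < T by rewrite powR_gt0.
have ne : 1 + eps != 0 by apply: lt0r_neq0; lra.
have VT : sigma `^ (2 * eps / (1 + eps)) = T ^+ 2.
  by rewrite -powR_mulrn ?ltW // -powRrM; congr (_ `^ _); field.
have sT : sigma `^ (- eps) = T `^ (- (1 + eps)).
  by rewrite /T -powRrM; congr (_ `^ _); field.
rewrite VT; case: (leP w T) => wT.
  apply: le_trans (_ : T ^+ 2 * D <= _); last first.
    by rewrite ler_wpM2l ?sqr_ge0 // lerDl !mulr_ge0.
  rewrite mulrC ler_wpM2r // ler_sqr ?nnegrE ?(ltW T0) //; exact: le_trans wT.
have w00 : 0 < w by apply: lt_trans wT.
apply: le_trans (_ : T ^+ 2 * (m * sigma `^ (- eps) * w `^ (1 + eps)) <= _); last first.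
  by rewrite ler_wpM2l ?sqr_ge0 // lerDr.
have -> : T ^+ 2 * (m * sigma `^ (- eps) * w `^ (1 + eps)) =
    m * (w ^+ 2 * (T / w) `^ (1 - eps)).
  rewrite sT powRM ?invr_ge0 // ?ltW // -powR_inv1 ?ltW // -powRrM.
  rewrite -!powR_mulrn ?ltW //.
  transitivity (m * (T `^ (2%:R + - (1 + eps))) * w `^ (1 + eps)).
    rewrite [T `^ (2%:R + _)]powRD ?(gt_eqF T0) ?implybT //. ring.
  transitivity (m * (T `^ (1 - eps)) * w `^ (2%:R + -1 * (1 - eps))).
    by congr (_ * _ `^ _ * _ `^ _); ring.
  by rewrite [w `^ (2%:R + _)]powRD ?(gt_eqF w00) ?implybT //; ring.
apply: ler_pM => //; first exact: sqr_ge0.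
apply: le_trans (_ : w ^+ 2 <= _); first by rewrite ler_sqr ?nnegrE ?(ltW w00).
rewrite ler_peMr ?sqr_ge0 // -[leLHS](powRr0 (T / w)).
apply: ger_powR; last lra.
by rewrite divr_gt0 // ler_pdivrMr // mul1r ltW.
Qed.

(* The factor is small enough for the square of the tilt to be absorbed by
   half of the excess risk in [tilt_moment]. *)
Definition tilt (R : realType) (eps sigma M y f h : R) : R :=
  (16 * (1 + M) * variance_scale eps sigma)^-1 *
  (huber sigma (y - h) - huber sigma (y - f)).

(** Brings the tilt into the range of [expR_le_quadratic]: the two losses differ by at most 2 sigma
    times 2 M, and sigma is at most the variance scale. *)
Lemma tilt_bound (R : realType) (eps sigma M y f h : R) :
  2 * M < sigma -> 1 < sigma -> `|f| <= M -> `|h| <= M ->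
  `|tilt eps sigma M y f h| <= 1 / 4.
Proof.
move=> sM s1 fM hM; have M0 : 0 <= M by apply: le_trans fM.
have sV := @le_variance_scale _ eps sigma (ltW s1).
have k0 : 0 < 16 * (1 + M) * variance_scale eps sigma.
  by rewrite !mulr_gt0 //; lra.
rewrite normrM ger0_norm ?invr_ge0 ?(ltW k0) // ler_pdivrMl //.
have wh : `|y - h| <= `|y| + M by apply: le_trans (ler_normB _ _) _; lra.
have wf : `|y - f| <= `|y| + M by apply: le_trans (ler_normB _ _) _; lra.
apply: le_trans (huber_lipschitz _ wh wf) _; first by lra.
have min1 : Num.min sigma (`|y| + M) <= sigma by rewrite ge_min lexx.
have d : `|y - h - (y - f)| <= 2 * M.
  rewrite (_ : _ - _ = f - h); last by ring.
  by apply: le_trans (ler_normB _ _) _; lra.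
apply: le_trans (_ : 2 * sigma * (2 * M) <= _); first last.
  nra.
have min0 : 0 <= Num.min sigma (`|y| + M) by rewrite le_min addr_ge0 // andbT; lra.
by apply: ler_pM => //; [exact: mulr_ge0 | exact: ler_wpM2l].
Qed.

(** Up to two biases, the linear part is the difference of square losses, expanded around g. The
    square of the tilt costs at most half of (f - g)^2 + (h - g)^2. The term in (f - h) (y - g) is
    kept exactly, since it integrates to zero when g is the conditional mean. *)
Lemma tilt_moment (R : realType) (eps sigma M y f g h : R) :
  0 < eps -> 2 * M < sigma -> 1 < sigma -> `|f| <= M -> `|g| <= M -> `|h| <= M ->
  let u := tilt eps sigma M y f h in
  u + u ^+ 2 <= (16 * (1 + M) * variance_scale eps sigma)^-1 *
    (- (f - g) ^+ 2 / 2 + 3 / 2 * (h - g) ^+ 2 + 2 * ((f - h) * (y - g))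
     + (8 * M * 2 `^ eps + M) * (sigma `^ (- eps) * (`|y| + M) `^ (1 + eps))).
Proof.
move=> e0 sM s1 fM gM hM; have M0 : 0 <= M by apply: le_trans fM.
have s0 : 0 < sigma by lra.
have sV := @le_variance_scale _ eps sigma (ltW s1).
rewrite /tilt /=; set V := variance_scale eps sigma in sV *.
set l := (_ * V)^-1; set z := huber _ _ - _.
have V0 : 0 < V by lra.
have l0 : 0 < l by rewrite invr_gt0 !mulr_gt0 //; lra.
have -> : l * z + (l * z) ^+ 2 = l * (z + l * z ^+ 2) by ring.
rewrite ler_wpM2l ?(ltW l0) //.
have wh : `|y - h| <= `|y| + M by apply: le_trans (ler_normB _ _) _; lra.
have wf : `|y - f| <= `|y| + M by apply: le_trans (ler_normB _ _) _; lra.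
have w0 : 0 <= `|y| + M by rewrite addr_ge0.
set W := sigma `^ (- eps) * (`|y| + M) `^ (1 + eps).
have W0 : 0 <= W by rewrite mulr_ge0 ?powR_ge0.
have bf := huber_bias y e0 sM s1 fM gM; have bh := huber_bias y e0 sM s1 hM gM.
have hz : z <= - (f - g) ^+ 2 + (h - g) ^+ 2 + 2 * ((f - h) * (y - g))
     + 8 * M * 2 `^ eps * W.
  move: bf bh; rewrite -mulrA -/W !ler_norml => /andP[bf _] /andP[_ bh].
  by rewrite /z; lra.
have hz2 : l * z ^+ 2 <= (f - g) ^+ 2 / 2 + (h - g) ^+ 2 / 2 + M * W.
  have z2 : z ^+ 2 <= 4 * ((f - h) ^+ 2 * Num.min sigma (`|y| + M) ^+ 2).
    have := huber_lipschitz (ltW s0) wh wf; rewrite -/z => hl.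
    rewrite -(real_normK (num_real z)).
    apply: le_trans (_ : (2 * Num.min sigma (`|y| + M) * `|y - h - (y - f)|) ^+ 2 <= _).
      by rewrite ler_sqr ?nnegrE // !mulr_ge0 // le_min w0 ltW.
    rewrite !exprMn (real_normK (num_real _)) (_ : y - h - (y - f) = f - h); last by ring.
    lra.
  have dm : 0 <= (f - h) ^+ 2 <= 4 * M ^+ 2.
    rewrite sqr_ge0 /=; move: fM hM; rewrite !ler_norml => /andP[? ?] /andP[? ?]; nra.
  have := sqr_le_truncated_moment e0 s1 w0 dm; rewrite -/V => hD.
  have lV : l * V = (16 * (1 + M))^-1.
    by rewrite /l invfM mulfVK // gt_eqF.
  apply: le_trans (_ : l * (4 * (V * ((f - h) ^+ 2 + 4 * M ^+ 2 * W))) <= _).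
    rewrite ler_wpM2l ?(ltW l0) //; apply: le_trans z2 _; rewrite ler_wpM2l //.
    by apply: le_trans hD _; rewrite /W !mulrA.
  have -> : l * (4 * (V * ((f - h) ^+ 2 + 4 * M ^+ 2 * W))) =
     (16 * (1 + M))^-1 * (4 * ((f - h) ^+ 2 + 4 * M ^+ 2 * W)) by rewrite -lV; ring.
  rewrite ler_pdivrMl; last by lra.
  have fh : (f - h) ^+ 2 <= 2 * (f - g) ^+ 2 + 2 * (h - g) ^+ 2.
    by rewrite -subr_ge0 (_ : _ - _ = (f + h - 2 * g) ^+ 2); [exact: sqr_ge0 | ring].
  have q1 : 0 <= (f - g) ^+ 2 := sqr_ge0 _.
  have q2 : 0 <= (h - g) ^+ 2 := sqr_ge0 _.
  move: q1 q2 fh; move: ((f - g) ^+ 2) ((h - g) ^+ 2) ((f - h) ^+ 2) => p q r.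
  move=> p0 q0 fh; have := mulr_ge0 M0 p0; have := mulr_ge0 M0 q0.
  by have := mulr_ge0 M0 W0; have := mulr_ge0 M0 (mulr_ge0 M0 W0); lra.
lra.
Qed.

(** * Chernoff bound for independent samples *)

(** Squaring 1 - u / 2 <= e^(-u / 2) gives e^u <= (1 - u / 2)^-2. The claim then reduces to the sign
    of 1 - 3 u + u^2, which is positive for |u| <= 1 / 4. *)
Lemma expR_le_quadratic (R : realType) (u : R) :
  `|u| <= 1 / 4 -> expR u <= 1 + u + u ^+ 2.
Proof.
rewrite ler_norml => /andP[u1 u2].
have h : (1 - u / 2) ^+ 2 <= expR (- u).
  have -> : - u = 2%:R * (- u / 2) by field.
  rewrite expRM_natl ler_sqr ?nnegrE ?expR_ge0 //; last lra.
  by apply: le_trans (expR_ge1Dx _); lra.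
have p0 : 0 < (1 - u / 2) ^+ 2 by rewrite exprn_gt0 //; lra.
rewrite -[expR u]invrK -expRN.
apply: le_trans (_ : ((1 - u / 2) ^+ 2)^-1 <= _).
  by rewrite lef_pV2 ?posrE ?expR_gt0.
rewrite -div1r ler_pdivrMr //.
have -> : (1 + u + u ^+ 2) * (1 - u / 2) ^+ 2 =
  1 + u ^+ 2 * (1 - 3 * u + u ^+ 2) / 4 by field.
rewrite lerDl divr_ge0 // mulr_ge0 ?sqr_ge0 //.
by have := sqr_ge0 u; lra.
Qed.

Section RealIntegrable.
Context d (T : measurableType d) (R : realType) (mu : probability T R).
Implicit Types (D : set T) (f g : T -> R).

Lemma integrable_bounded D f B : measurable D -> measurable_fun D f ->
  (forall x, D x -> `|f x| <= B) -> mu.-integrable D (EFin \o f).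
Proof.
move=> mD mf fB; apply: measurable_bounded_integrable => //.
  by rewrite (le_lt_trans (probability_le1 _ _)) ?ltry.
exists B; split=> [|r Br x Dx]; first exact: num_real.
exact: le_trans (fB _ Dx) (ltW Br).
Qed.

Lemma integrableD_EFin D f g : measurable D ->
  mu.-integrable D (EFin \o f) -> mu.-integrable D (EFin \o g) ->
  mu.-integrable D (EFin \o (fun x => f x + g x)).
Proof. by move=> mD fi gi; exact: (integrableD mD fi gi). Qed.

Lemma integrableZl_EFin D f k : measurable D ->
  mu.-integrable D (EFin \o f) -> mu.-integrable D (EFin \o (fun x => k * f x)).
Proof. by move=> mD fi; exact: (integrableZl mD k fi). Qed.

End RealIntegrable.

Lemma probability_bigsetU_le d (T : measurableType d) (R : realType)
    (P : probability T R) (I : Type) (s : seq I) (Q : pred I) (A : I -> set T) :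
  (forall i, measurable (A i)) ->
  (P (\big[setU/set0]_(i <- s | Q i) A i) <= \sum_(i <- s | Q i) P (A i))%E.
Proof.
move=> mA; elim: s => [|i s IH]; first by rewrite !big_nil measure0.
rewrite !big_cons; case: ifP => // Qi.
apply: le_trans (measureU2 _ _ _) _ => //; first exact: bigsetU_measurable.
exact: leeD.
Qed.

(** Rounds g up to a grid of step k. Level i is the half-open interval from i k - B to (i + 1) k - B
    and carries its right endpoint, so that the approximation lies above g. *)
Lemma finite_level_approximation d (T : measurableType d) (R : realType)
    (g : T -> R) (B k : R) :
  measurable_fun setT g -> (forall x, `|g x| <= B) -> 0 < k ->
  exists K (j : T -> 'I_K) (c : 'I_K -> R),
    (forall i, measurable (j @^-1` [set i])) /\
    (forall x, g x <= c (j x) <= g x + k).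
Proof.
move=> mg gB k0.
have gB' x : - B <= g x <= B by rewrite -ler_norml.
pose q x := (g x + B) / k.
have q0 x : 0 <= q x by rewrite divr_ge0 ?(ltW k0) //; have := gB' x; lra.
pose K := (Num.trunc (2 * B / k)).+1.
have qK x : (Num.trunc (q x) < K)%N.
  rewrite ltnS; apply: le_truncn.
  by rewrite ler_pM2r ?invr_gt0 //; have := gB' x; lra.
exists K, (fun x => Ordinal (qK x)), (fun i => i.+1%:R * k - B); split.
  move=> i.
  rewrite (_ : _ @^-1` _ = g @^-1` `[i%:R * k - B, i.+1%:R * k - B[%classic).
    by rewrite -[X in measurable X]setTI; apply: mg.
  have e x : (Num.trunc (q x) == i) = (i%:R * k - B <= g x < i.+1%:R * k - B).
    rewrite truncn_eq // /q ler_pdivlMr // ltr_pdivrMr //.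
    by rewrite lerBlDr ltrBrDr.
  apply/seteqP; split => x /=; rewrite in_itv /= -e.
    by move=> /(congr1 val) /= ->.
  by move=> /eqP xi; apply: val_inj.
move=> x /=; have := truncn_itv (q0 x); rewrite /q.
rewrite ler_pdivlMr // ltr_pdivrMr // -natr1; lra.
Qed.

Lemma measurable_finite_levels d d' (T : measurableType d) (S : measurableType d')
    (K : nat) (j : T -> 'I_K) (c : 'I_K -> S) :
  (forall i, measurable (j @^-1` [set i])) -> measurable_fun setT (fun x => c (j x)).
Proof.
move=> mj _ Y _; rewrite setTI.
rewrite (_ : _ @^-1` Y = \big[setU/set0]_(l | `[< Y (c l) >]) (j @^-1` [set l])).
  by apply: bigsetU_measurable.
rewrite -bigcup_pred; apply/seteqP; split => [x /= Yx|x [l /= Yl xl] /=].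
  by exists (j x) => //=; rewrite unfold_in; apply/asboolP.
by rewrite xl; move: Yl; rewrite unfold_in => /asboolP.
Qed.

Lemma measurable_superlevel d (T : measurableType d) (R : realType) (f : T -> R) (t : R) :
  measurable_fun setT f -> measurable [set x | t <= f x].
Proof.
move=> mf; rewrite (_ : mkset _ = f @^-1` `[t, +oo[%classic).
  by rewrite -[X in measurable X]setTI; exact: mf.
by apply/seteqP; split => x /=; rewrite in_itv /= andbT.
Qed.

Section ChernoffIid.
Context d (T : measurableType d) (R : realType) (mu : probability T R).
Context dO (Omega : measurableType dO) (P : probability Omega R).
Variables (n : nat) (Z : 'I_n -> Omega -> T).
Hypothesis mZ : forall i, measurable_fun setT (Z i).
Hypothesis lawZ : forall i A, measurable A -> P (Z i @^-1` A) = mu A.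
Hypothesis indepZ : forall A : 'I_n -> set T, (forall i, measurable (A i)) ->
  fine (P (\bigcap_(i in [set: 'I_n]) (Z i @^-1` A i)))
  = \prod_(i < n) fine (P (Z i @^-1` A i)).

Let measurable_box (A : 'I_n -> set T) : (forall i, measurable (A i)) ->
  measurable (\bigcap_(i in [set: 'I_n]) (Z i @^-1` A i)).
Proof.
move=> mA; apply: fin_bigcap_measurable => // i _.
by rewrite -[X in measurable X]setTI; exact: mZ.
Qed.

(* When the increments take finitely many values the event is a finite union
   of boxes, so that the product rule for boxes replaces the expectation of a
   product of independent variables. *)
Lemma chernoff_levels (K : nat) (j : T -> 'I_K) (c : 'I_K -> R) (t : R) :
  (forall i, measurable (j @^-1` [set i])) ->
  (P [set w | (t <= \sum_(i < n) c (j (Z i w)))%R] <=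
   (expR (- t) * (\sum_(l < K) expR (c l) * fine (mu (j @^-1` [set l]))) ^+ n)%:E)%E.
Proof.
move=> mj; pose Box (J : {ffun 'I_n -> 'I_K}) :=
  \bigcap_(i in [set: 'I_n]) (Z i @^-1` (j @^-1` [set (J i)])).
have mBox J : measurable (Box J) by apply: measurable_box.
have -> : [set w | t <= \sum_(i < n) c (j (Z i w))] =
    \big[setU/set0]_(J : {ffun 'I_n -> 'I_K} | t <= \sum_(i < n) c (J i)) Box J.
  rewrite -bigcup_pred; apply/seteqP; split => [w /= tw|w [J /= tJ JB] /=].
    exists [ffun i => j (Z i w)] => /=.
      by rewrite unfold_in /=; under eq_bigr do rewrite ffunE.
    by move=> i _ /=; rewrite ffunE.
  move: tJ; rewrite unfold_in /= => tJ.
  by under eq_bigr do rewrite (JB _ I).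
apply: le_trans (probability_bigsetU_le _ _ _ mBox) _.
have PBox J : P (Box J) = (\prod_(i < n) fine (mu (j @^-1` [set (J i)])))%:E.
  rewrite -[LHS]fineK ?fin_num_measure // indepZ //.
  by congr (_%:E); apply: eq_bigr => i _; rewrite lawZ.
under eq_bigr do rewrite PBox.
rewrite sumEFin lee_fin.
(* Expanding the n-th power gives one nonnegative term per pattern of levels. For patterns whose sum
   reaches t the exponential factor is at least 1, so the term dominates the probability of the
   box. *)
rewrite -[n in _ ^+ n]card_ord -prodr_const bigA_distr_bigA /= mulr_sumr.
rewrite big_mkcond /=; apply: ler_sum => J _.
have p0 l : 0 <= fine (mu (j @^-1` [set l])) by rewrite fine_ge0.
case: ifPn => [tJ|_]; last first.
  by rewrite mulr_ge0 ?expR_ge0 // prodr_ge0 // => i _; rewrite mulr_ge0 ?expR_ge0.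
rewrite big_split /= -expR_sum mulrA -expRD ler_peMl ?prodr_ge0 //.
by rewrite -[leLHS](expR0) ler_expR; lra.
Qed.

(** Rounding u up to levels of step k only enlarges the event and costs a factor e^(n k), which
    tends to 1 with k. The moment generating function is then bounded by 1 + u + u^2 inside the
    integral and by 1 + x <= e^x outside. *)
Lemma chernoff_iid (u : T -> R) (t : R) :
  measurable_fun setT u -> (forall x, `|u x| <= 1 / 4) ->
  (P [set w | (t <= \sum_(i < n) u (Z i w))%R] <=
   (expR (n%:R * \int[mu]_x (u x + u x ^+ 2) - t))%:E)%E.
Proof.
move=> mu_ u1; set v := fun x => u x + u x ^+ 2.
have mv : measurable_fun setT v.
  by apply: measurable_funD => //; exact: measurable_funX.
have v1 x : - 1 <= v x <= 1 by have := u1 x; rewrite /v ler_norml => /andP[? ?]; nra.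
have iv : mu.-integrable setT (EFin \o v).
  by apply: integrable_bounded => // x _; rewrite ler_norml; exact: v1.
have i1v : mu.-integrable setT (EFin \o (fun x => 1 + v x)).
  by apply: integrableD_EFin => //; exact: finite_measure_integrable_cst.
have level k : 0 < k -> (P [set w | (t <= \sum_(i < n) u (Z i w))%R] <=
   (expR (n%:R * k) * expR (n%:R * \int[mu]_x v x - t))%:E)%E.
  move=> k0; have [K [j [c [mj cj]]]] := finite_level_approximation mu_ u1 k0.
  have mS : measurable [set w | t <= \sum_(i < n) u (Z i w)].
    apply: (@measurable_superlevel _ _ _ (fun w => \sum_(i < n) u (Z i w))).
    by apply: measurable_sum => i; exact: measurableT_comp.
  have mS' : measurable [set w | t <= \sum_(i < n) c (j (Z i w))].
    apply: (@measurable_superlevel _ _ _ (fun w => \sum_(i < n) c (j (Z i w)))).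
    apply: measurable_sum => i.
    exact: (measurableT_comp (measurable_finite_levels c mj)).
  apply: le_trans (_ : (P [set w | (t <= \sum_(i < n) c (j (Z i w)))%R] <= _)%E).
    apply: le_measure; rewrite ?inE // => w /= tw; apply: le_trans tw _.
    by apply: ler_sum => i _; have /andP[] := cj (Z i w).
  apply: le_trans (chernoff_levels _ _ mj) _; rewrite lee_fin.
  rewrite expRD mulrA mulrC ler_wpM2r ?expR_ge0 //.
  rewrite -expRD -mulrDr expRM_natl lerXn2r ?nnegrE ?expR_ge0 //.
    by apply: sumr_ge0 => l _; rewrite mulr_ge0 ?expR_ge0 // fine_ge0.
  rewrite expRD.
  (* On the fibre of l, c l <= u + k, hence e^(c l) <= e^k (1 + u + u^2); the fibres partition the
     space. *)
  apply: le_trans (_ : \sum_(l < K) expR k * \int[mu]_(x in j @^-1` [set l]) (1 + v x) <= _).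
    apply: ler_sum => l _.
    have il : mu.-integrable (j @^-1` [set l]) (EFin \o (fun x => 1 + v x)).
      exact: integrableS i1v.
    rewrite -RintegralZl // -Rintegral_cst //.
    apply: le_Rintegral => //; first exact: finite_measure_integrable_cst.
      exact: integrableZl_EFin.
    move=> x /= <-; have /andP[_ cx] := cj x.
    apply: le_trans (_ : expR (u x + k) <= _); first by rewrite ler_expR.
    by rewrite expRD mulrC ler_wpM2l ?expR_ge0 // /v addrA expR_le_quadratic.
  rewrite -mulr_sumr ler_wpM2l ?expR_ge0 //.
  apply: le_trans (expR_ge1Dx _).
  have -> : 1 + \int[mu]_x v x = \int[mu]_x (1 + v x).
    rewrite [RHS]RintegralD //; last exact: finite_measure_integrable_cst.
    by rewrite Rintegral_cst // mul1r [X in fine X](probability_setT mu).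
  have jT : [set: T] = \big[setU/set0]_(l < K) (j @^-1` [set l]).
    rewrite -bigcup_pred; apply/seteqP; split => // x _.
    by exists (j x).
  rewrite le_eqVlt; apply/orP; left; apply/eqP.
  rewrite {2}/Rintegral jT ge0_integral_bigsetU //=.
  - rewrite -sum_fine //= => l _; apply: integrable_fin_num => //.
    exact: integrableS i1v.
  - by rewrite index_enum_uniq.
  - by apply/trivIsetP => /= a b _ _ ab; apply/seteqP; split => // x [/= -> ba]; rewrite ba eqxx in ab.
  - by rewrite -jT; case/integrableP : i1v.
  - by move=> x _; rewrite lee_fin; have := v1 x; lra.
apply/lee_addgt0Pr => e e0.
set b := expR (_ - t).
have b0 : 0 < b by exact: expR_gt0.
(* Chosen so that e^(n k) <= 1 + e / b; dividing by n + 1 keeps k positive when n = 0. *)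
pose k := ln (1 + e / b) / (n.+1)%:R.
have eb : 0 < e / b by rewrite divr_gt0.
have k0 : 0 < k by rewrite divr_gt0 // ln_gt0 //; lra.
apply: le_trans (level _ k0) _; rewrite -/b -EFinD lee_fin.
apply: le_trans (_ : (1 + e / b) * b <= _); last first.
  by rewrite mulrDl mul1r divfK ?gt_eqF.
rewrite ler_pM2r // -[leRHS]lnK ?posrE; last by lra.
rewrite ler_expR /k mulrCA ler_piMr //; first by rewrite ln_ge0 //; lra.
by rewrite ler_pdivrMr // mul1r ler_nat.
Qed.

End ChernoffIid.

(** * Conditional means *)

Section ConditionalMeanZero.
Context d (T : measurableType d) (R : realType) (mu : probability (T * R)%type R).

(** If g is replaced by a step function, the integral splits over cylinders on which h integrates to
    zero. The error is at most the step k times the integral of |h|, and k is arbitrary. *)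
Lemma Rintegral_conditional_mean_zero (h : T * R -> R) (g : T -> R) (B : R) :
  mu.-integrable setT (EFin \o h) ->
  (forall A, measurable A -> \int[mu]_(z in A `*` [set: R]) h z = 0) ->
  measurable_fun setT g -> (forall x, `|g x| <= B) ->
  mu.-integrable setT (EFin \o (fun z => g z.1 * h z)) /\
  \int[mu]_z (g z.1 * h z) = 0.
Proof.
move=> ih h0 mg gB.
have mh : measurable_fun setT h by case/integrableP : ih => /measurable_EFinP.
have mg1 : measurable_fun setT (fun z : T * R => g z.1).
  exact: measurableT_comp.
have B0 : 0 <= B by apply: le_trans (gB point).
have dominated (k : R) (f : T * R -> R) : 0 <= k -> measurable_fun setT f ->
    (forall z, `|f z| <= k) -> mu.-integrable setT (EFin \o (fun z => f z * h z)).
  move=> k0 mf fk.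
  apply: (@le_integrable _ _ _ mu _ measurableT _ (EFin \o (fun z => k * h z))).
  - by apply/measurable_EFinP; exact: measurable_funM.
  - by move=> z _ /=; rewrite lee_fin !normrM ler_wpM2r // (ger0_norm k0).
  - exact: integrableZl_EFin.
have igh : mu.-integrable setT (EFin \o (fun z => g z.1 * h z)).
  by apply: (dominated B).
split=> //; apply/eqP; rewrite -normr_le0; apply/ler_addgt0Pr => e e0; rewrite add0r.
set H1 := \int[mu]_z `|h z|.
have H10 : 0 <= H1 by apply: Rintegral_ge0.
pose k := e / (1 + H1).
have k0 : 0 < k by rewrite divr_gt0 //; lra.
have [K [j [c [mj cj]]]] := finite_level_approximation mg gB k0.
pose D l := (j @^-1` [set l]) `*` [set: R].
have mD l : measurable (D l) by exact: measurableX.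
have tD : trivIset [set` index_enum 'I_K] D.
  by apply/trivIsetP => a b _ _ ab; apply/seteqP; split => // z /= [[/= za _] [/= zb _]];
    rewrite -za -zb eqxx in ab.
have UD : \big[setU/set0]_(l < K) D l = setT.
  rewrite -bigcup_pred; apply/seteqP; split => // z _.
  by exists (j z.1) => //=; split.
have mc : measurable_fun setT (fun z : T * R => c (j z.1)).
  exact: (measurableT_comp (measurable_finite_levels c mj) measurable_fst).
have cB z : `|c (j z.1)| <= B + k.
  have /andP[c1 c2] := cj z.1; have := gB z.1.
  by rewrite !ler_norml => /andP[? ?]; apply/andP; split; lra.
have ich : mu.-integrable setT (EFin \o (fun z => c (j z.1) * h z)).
  by apply: (dominated (B + k)) => //; lra.
have c0 : \int[mu]_z (c (j z.1) * h z) = 0.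
  rewrite /Rintegral -UD integral_bigsetU_EFin //=; last 2 first.
  - by rewrite index_enum_uniq.
  - by rewrite UD; apply/measurable_EFinP; exact: measurable_funM.
  rewrite big1 // => l _.
  rewrite (eq_integral (fun z => (c l * h z)%:E)); last first.
    by move=> z; rewrite inE => -[/= -> _].
  have ihl : mu.-integrable (D l) (EFin \o h) by exact: integrableS ih.
  have icl : mu.-integrable (D l) (EFin \o (fun z => c l * h z)).
    exact: integrableZl_EFin.
  rewrite -[LHS]fineK; last exact: integrable_fin_num.
  by rewrite -[fine _]/(Rintegral _ _ _) RintegralZl // h0 // mulr0.
rewrite -[X in `|X|]subr0 -c0 -RintegralB //.
apply: le_trans (_ : \int[mu]_z (k * `|h z|) <= _).
  apply: le_trans (le_normr_Rintegral measurableT _) _.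
    exact: (integrableB measurableT igh ich).
  apply: le_Rintegral => //.
  - apply: integrable_norm; exact: (integrableB measurableT igh ich).
  - apply: integrableZl_EFin => //; exact: integrable_norm.
  - move=> z _; rewrite -mulrBl normrM ler_wpM2r //.
    by rewrite distrC ler_norml; have := cj z.1; lra.
rewrite RintegralZl //; last exact: integrable_norm.
rewrite -/H1 /k mulrAC ler_pdivrMr; last by lra.
by rewrite ler_wpM2l ?(ltW e0) //; lra.
Qed.

End ConditionalMeanZero.

(** * Covers and measurability on compact sets *)

(* [compact_cover] is stated for pointed spaces. *)
HB.instance Definition _ (R : realType) (d : nat) (X : set 'rV[R]_d) :=
  isPointed.Build {uniform` X -> R} (fun=> 0).

(** Rules out the default value 0 in [covering_number]. The radius is halved because a pointwise
    strict bound only yields a weak bound on the supremum. *)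
Lemma compact_has_cover (R : realType) (d : nat) (X : set 'rV[R]_d)
    (H : set ('rV[R]_d -> R)) (eta : R) :
  compact (H : set {uniform` X -> R}) -> 0 < eta -> exists k, has_cover X H eta k.
Proof.
move=> cH e0.
pose U (g : {uniform` X -> R}) : set {uniform` X -> R} :=
  interior [set h : {uniform` X -> R} | forall x, X x -> `|g x - h x| < eta / 2].
have e20 : 0 < eta / 2 by rewrite divr_gt0.
have gU g : U g g.
  apply/uniform_nbhs; exists [set xy | ball xy.1 (eta / 2) xy.2]; split => //.
  exact: entourage_ball (PosNum e20).
move: cH; rewrite compact_cover => /(_ {uniform` X -> R} H U).
case => [g _|g Hg|D DH HD]; first exact: open_interior.
  by exists g.
pose s : seq {uniform` X -> R} := finmap.enum_fset D.
exists (size s), (tnth (in_tuple s)); split.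
  by move=> i; apply/set_mem/DH; exact: mem_tnth.
move=> f Hf; have [g /= gD /interior_subset /= fg] := HD f Hf.
have /tnthP [i gi] : g \in in_tuple s by exact: gD.
exists i => //=; rewrite -gi.
apply: le_lt_trans (_ : eta / 2 < eta); last by lra.
(* The supremum over an empty X is 0 by convention. *)
have [X0|/set0P [x0 Xx0]] := eqVneq X set0.
  by rewrite /supnormX X0 image_set0 sup0 ltW.
apply: ge_sup; first by exists `|(f \- g) x0|, x0.
by move=> _ [x Xx <-]; rewrite distrC ltW // fg.
Qed.

Lemma supnormX_ge (R : realType) (d : nat) (X : set 'rV[R]_d) (f : 'rV[R]_d -> R) (B : R) x :
  (forall y, X y -> `|f y| <= B) -> X x -> `|f x| <= supnormX X f.
Proof.
move=> fB Xx; apply: ub_le_sup; last by exists x.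
by exists B => _ [y Xy <-]; exact: fB.
Qed.

(** The uniform bound B makes the supremum norm of a difference a genuine supremum, so that
    closeness in norm gives closeness at each point of X. *)
Lemma covering_numberP (R : realType) (d : nat) (X : set 'rV[R]_d)
    (H : set ('rV[R]_d -> R)) (eta B : R) :
  compact (H : set {uniform` X -> R}) -> 0 < eta ->
  (forall f x, H f -> X x -> `|f x| <= B) ->
  exists fs : 'I_(covering_number X H eta) -> ('rV[R]_d -> R),
    (forall i, H (fs i)) /\
    forall f, H f -> exists i, forall x, X x -> `|f x - fs i x| <= eta.
Proof.
move=> cH e0 HB.
have [fs [Hfs cov]] : has_cover X H eta (covering_number X H eta).
  rewrite /covering_number; case: pselect => [ex|nex].
    by case: ex_minnP => m /asboolP.
  have [k hk] := compact_has_cover cH e0.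
  by exfalso; apply: nex; exists k; apply/asboolP.
exists fs; split=> // f Hf; have [i _ /= fi] := cov _ Hf.
exists i => x Xx; apply: ltW; apply: le_lt_trans fi.
apply: (@supnormX_ge _ _ X (f \- fs i) (B + B)) => // y Xy.
by apply: le_trans (ler_normB _ _) _; apply: lerD; apply: HB.
Qed.

Lemma compact_measurable_Rd (R : realType) (d : nat) (X : set 'rV[R]_d) :
  compact X -> measurable (X : set (Rd R d)).
Proof.
move=> /compact_closed cX; rewrite -[X]setCK; apply: measurableC.
apply: sub_sigma_algebra; apply: closed_openC; apply: cX.
exact: norm_hausdorff.
Qed.

(** Continuity is known on X only: preimages of open intervals are traces on X of open sets, hence
    Borel, and extension by zero gives a function measurable everywhere. *)
Lemma restrict_measurable_Rd (R : realType) (d : nat) (X : set 'rV[R]_d)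
    (f : 'rV[R]_d -> R) :
  compact X -> {within X, continuous f} ->
  measurable_fun [set: Rd R d] (f \_ X : Rd R d -> R).
Proof.
move=> cX cf; have mX := compact_measurable_Rd cX.
apply/(measurable_restrictT _ mX).
apply: (measurability _ (RGenOpens.measurableE R)).
move=> _ [_ [a [b ->] <-]].
have : open (f @^-1` `]a, b[%classic : set (subspace X)).
  by move: cf => /continuousP; apply; exact: interval_open.
move=> /open_subspaceP [V oV].
rewrite setIC [in RHS]setIC => VX; rewrite -VX.
apply: measurableI => //; exact: sub_sigma_algebra.
Qed.

(** * Risk bounds *)

Lemma measurable_huber (R : realType) (sigma : R) :
  measurable_fun setT (huber sigma).
Proof.
apply: measurable_fun_ifT => /=.
- by apply: measurable_fun_ler => //; exact: normr_measurable.
- exact: exprn_measurable.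
- by apply: measurable_funB => //; apply: measurable_funM.
Qed.

Section HuberRisk.
Context d (T : measurableType d) (R : realType) (mu : probability (T * R)%type R).
Variables (eps sigma M : R) (g h : T -> R).
Hypotheses (eps0 : 0 < eps) (sigmaM : 2 * M < sigma) (sigma1 : 1 < sigma).
Hypotheses (mg : measurable_fun setT g) (gM : forall x, `|g x| <= M).
Hypotheses (mh : measurable_fun setT h) (hM : forall x, `|h x| <= M).
Hypothesis moment : mu.-integrable setT
  (EFin \o (fun z => (`|z.2| + M) `^ (1 + eps))).
Hypothesis integrable_residual :
  mu.-integrable setT (EFin \o (fun z => z.2 - g z.1)).
Hypothesis mean0 : forall A, measurable A ->
  \int[mu]_(z in A `*` [set: R]) (z.2 - g z.1) = 0.

Definition sqdist (f1 f2 : T -> R) : R := \int[mu]_z (f1 z.1 - f2 z.1) ^+ 2.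

(** The increment fed to the Chernoff bound. In the application h is the best element of the class
    and g the regression function, both extended by zero off X. *)
Definition tilt_loss (f : T -> R) (z : T * R) : R :=
  tilt eps sigma M z.2 (f z.1) (h z.1).

(** The integral of the remainder in [tilt_moment], of order sigma^-eps. *)
Definition tilt_bias : R := (8 * M * 2 `^ eps + M) *
  (sigma `^ (- eps) * \int[mu]_z (`|z.2| + M) `^ (1 + eps)).

Let tilt_scale := (16 * (1 + M) * variance_scale eps sigma)^-1.

Let M0 : 0 <= M. Proof. exact: le_trans (gM point). Qed.

Lemma integrable_sqdist (f1 f2 : T -> R) :
  measurable_fun setT f1 -> (forall x, `|f1 x| <= M) ->
  measurable_fun setT f2 -> (forall x, `|f2 x| <= M) ->
  mu.-integrable setT (EFin \o (fun z => (f1 z.1 - f2 z.1) ^+ 2)).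
Proof.
move=> m1 b1 m2 b2; apply: (@integrable_bounded _ _ _ _ _ _ (4 * M ^+ 2)) => //.
  by apply: measurable_funX; apply: measurable_funB; exact: measurableT_comp.
move=> z _; move: (b1 z.1) (b2 z.1).
by rewrite !ler_norml => /andP[? ?] /andP[? ?]; apply/andP; split; nra.
Qed.

Lemma sqdist_le (f1 f2 : T -> R) :
  measurable_fun setT f1 -> (forall x, `|f1 x| <= M) ->
  measurable_fun setT f2 -> (forall x, `|f2 x| <= M) ->
  sqdist f1 f2 <= 4 * M ^+ 2.
Proof.
move=> m1 b1 m2 b2; apply: le_trans (_ : \int[mu]_z (4 * M ^+ 2) <= _).
  apply: le_Rintegral => //; first exact: integrable_sqdist.
    exact: finite_measure_integrable_cst.
  move=> z _; have := b1 z.1; have := b2 z.1.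
  by rewrite !ler_norml => /andP[? ?] /andP[? ?]; nra.
by rewrite Rintegral_cst // [X in fine X](probability_setT mu) mulr1.
Qed.

Lemma sqdist_triangle (f1 f2 : T -> R) (eta : R) :
  measurable_fun setT f1 -> (forall x, `|f1 x| <= M) ->
  measurable_fun setT f2 -> (forall x, `|f2 x| <= M) ->
  (forall x, `|f1 x - f2 x| <= eta) ->
  sqdist f1 g <= 2 * sqdist f2 g + 2 * eta ^+ 2.
Proof.
move=> m1 b1 m2 b2 f12.
have i2 := integrable_sqdist m2 b2 mg gM.
have i2' := integrableZl_EFin 2 measurableT i2.
have ie : mu.-integrable setT (EFin \o (fun=> 2 * eta ^+ 2)).
  exact: finite_measure_integrable_cst.
apply: le_trans (_ : \int[mu]_z (2 * (f2 z.1 - g z.1) ^+ 2 + 2 * eta ^+ 2) <= _).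
  apply: le_Rintegral => //; first exact: integrable_sqdist.
    exact: integrableD_EFin.
  move=> z _; have := f12 z.1; rewrite ler_norml => /andP[e1 e2].
  (* The gap in (a + b)^2 <= 2 a^2 + 2 b^2 is (a - b)^2, with a = f1 - f2 and b = f2 - g. *)
  have := sqr_ge0 (f1 z.1 - 2 * f2 z.1 + g z.1).
  have : (f1 z.1 - f2 z.1) ^+ 2 <= eta ^+ 2.
    by rewrite -(real_normK (num_real (f1 z.1 - f2 z.1))) ler_sqr ?nnegrE //;
      apply: le_trans (f12 z.1).
  by rewrite !expr2; lra.
rewrite RintegralD // RintegralZl //.
by rewrite Rintegral_cst // [X in fine X](probability_setT mu) mulr1.
Qed.

Lemma measurable_tilt_loss (f : T -> R) :
  measurable_fun setT f -> measurable_fun setT (tilt_loss f).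
Proof.
move=> mf; apply: measurable_funM => //; apply: measurable_funB.
- apply: measurableT_comp; first exact: measurable_huber.
  by apply: measurable_funB => //; exact: measurableT_comp.
- apply: measurableT_comp; first exact: measurable_huber.
  by apply: measurable_funB => //; exact: measurableT_comp.
Qed.

(** Integrates [tilt_moment]; the cross term vanishes because f - h depends on x alone and the
    residual has conditional mean zero. *)
Lemma Rintegral_tilt_le (f : T -> R) :
  measurable_fun setT f -> (forall x, `|f x| <= M) ->
  \int[mu]_z (tilt_loss f z + tilt_loss f z ^+ 2) <=
  tilt_scale * (- sqdist f g / 2 + 3 / 2 * sqdist h g + tilt_bias).
Proof.
move=> mf fM.
have ifg := integrable_sqdist mf fM mg gM; have ihg := integrable_sqdist mh hM mg gM.
have [icross cross0] : mu.-integrable setT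
    (EFin \o (fun z => (f z.1 - h z.1) * (z.2 - g z.1))) /\
    \int[mu]_z ((f z.1 - h z.1) * (z.2 - g z.1)) = 0.
  apply: (@Rintegral_conditional_mean_zero _ _ _ mu _ (fun x => f x - h x) (2 * M)) => //.
    exact: measurable_funB.
  by move=> x; apply: le_trans (ler_normB _ _) _; have := fM x; have := hM x; lra.
have i1 := integrableZl_EFin (- 2^-1) measurableT ifg.
have i2 := integrableZl_EFin (3 / 2) measurableT ihg.
have i3 := integrableZl_EFin 2 measurableT icross.
have i4 := integrableZl_EFin ((8 * M * 2 `^ eps + M) * sigma `^ (- eps)) measurableT moment.
have i12 := integrableD_EFin measurableT i1 i2.
have i123 := integrableD_EFin measurableT i12 i3.
have i1234 := integrableD_EFin measurableT i123 i4.
have it : mu.-integrable setT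
    (EFin \o (fun z => tilt_loss f z + tilt_loss f z ^+ 2)).
  have mt := measurable_tilt_loss mf.
  apply: (@integrable_bounded _ _ _ _ _ _ 1) => //.
    by apply: measurable_funD => //; exact: measurable_funX.
  move=> z _; have := @tilt_bound R eps sigma M z.2 _ _ sigmaM sigma1 (fM z.1) (hM z.1).
  by rewrite -/(tilt_loss f z) !ler_norml => /andP[? ?]; apply/andP; split; nra.
apply: (@le_trans _ _ (\int[mu]_z (tilt_scale *
    (- 2^-1 * (f z.1 - g z.1) ^+ 2 + 3 / 2 * (h z.1 - g z.1) ^+ 2
     + 2 * ((f z.1 - h z.1) * (z.2 - g z.1))
     + (8 * M * 2 `^ eps + M) * sigma `^ (- eps) * (`|z.2| + M) `^ (1 + eps))))).
  apply: le_Rintegral => //; first exact: integrableZl_EFin.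
  move=> z _; apply: le_trans (tilt_moment z.2 eps0 sigmaM sigma1 (fM _) (gM _) (hM _)) _.
  by rewrite le_eqVlt; apply/orP; left; apply/eqP; congr (_ * _); ring.
rewrite RintegralZl // RintegralD // RintegralD // RintegralD //.
rewrite !RintegralZl // cross0 /tilt_bias -/(sqdist f g) -/(sqdist h g).
by rewrite le_eqVlt; apply/orP; left; apply/eqP; congr (_ * _); ring.
Qed.

Section Sample.
Context dO (Omega : measurableType dO) (P : probability Omega R).
Variables (n : nat) (Z : 'I_n -> Omega -> (T * R)%type).
Hypothesis mZ : forall i, measurable_fun setT (Z i).
Hypothesis lawZ : forall i A, measurable A -> P (Z i @^-1` A) = mu A.
Hypothesis indepZ : forall A : 'I_n -> set (T * R)%type, (forall i, measurable (A i)) ->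
  fine (P (\bigcap_(i in [set: 'I_n]) (Z i @^-1` A i)))
  = \prod_(i < n) fine (P (Z i @^-1` A i)).

(** Union bound over the net: the term ln (N / delta) in the threshold makes each failure have
    probability at most delta / N. *)
Lemma uniform_tilt_deviation (N : nat) (fs : 'I_N -> T -> R) (delta : R) :
  (0 < N)%N -> 0 < delta ->
  (forall j, measurable_fun setT (fs j)) -> (forall j x, `|fs j x| <= M) ->
  exists E : set Omega, measurable E /\ (P E >= (1 - delta)%:E)%E /\
    forall w, E w -> forall j,
      \sum_(i < n) tilt_loss (fs j) (Z i w) <
      n%:R * (tilt_scale * (- sqdist (fs j) g / 2 + 3 / 2 * sqdist h g + tilt_bias))
      + ln (N%:R / delta).
Proof.
move=> N0 delta0 mfs fsM.
have NR : 0 < N%:R :> R by rewrite ltr0n.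
pose t j := n%:R * (tilt_scale * (- sqdist (fs j) g / 2 + 3 / 2 * sqdist h g + tilt_bias))
      + ln (N%:R / delta).
pose bad j := [set w | t j <= \sum_(i < n) tilt_loss (fs j) (Z i w)].
have mbad j : measurable (bad j).
  apply: (@measurable_superlevel _ _ _ (fun w => \sum_(i < n) tilt_loss (fs j) (Z i w))).
  apply: measurable_sum => i; apply: measurableT_comp => //.
  exact: measurable_tilt_loss.
have Pbad j : (P (bad j) <= (delta / N%:R)%:E)%E.
  apply: le_trans (chernoff_iid mZ lawZ indepZ _ (measurable_tilt_loss (mfs j)) _) _.
    by move=> z; exact: tilt_bound.
  rewrite lee_fin -[leRHS]lnK ?posrE ?divr_gt0 // ler_expR.
  have -> : ln (delta / N%:R) = - ln (N%:R / delta).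
    by rewrite -lnV ?posrE ?divr_gt0 // invf_div.
  rewrite /t opprD addrA gerDr subr_le0 ler_wpM2l //.
  exact: Rintegral_tilt_le.
exists (~` \big[setU/set0]_(j < N) bad j).
have mU : measurable (\big[setU/set0]_(j < N) bad j) by exact: bigsetU_measurable.
split; first exact: measurableC.
split.
  have Pc : (P (\big[setU/set0]_(j < N) bad j) <= delta%:E)%E.
    apply: le_trans (probability_bigsetU_le _ _ _ mbad) _.
    apply: le_trans (_ : (\sum_(j < N) (delta / N%:R)%:E <= _)%E).
      by apply: lee_sum => j _; exact: Pbad.
    rewrite sumEFin lee_fin sumr_const card_ord -[leLHS]mulr_natr.
    by rewrite divfK // gt_eqF.
  by rewrite probability_setC // EFinB leeB.
move=> w /= nw j; rewrite ltNge; apply/negP => bw; apply: nw.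
by rewrite -bigcup_pred; exists j.
Qed.

End Sample.

End HuberRisk.

(** * The statistical rate and the radius of the net *)

Section Rate.
Context (R : realType).
Variables (eps q sigma : R) (n : nat).
Hypotheses (q0 : 0 < q) (sigma1 : 1 < sigma) (n0 : (0 < n)%N).

(* The second summand of [Psi], in both regimes of eps. *)
Definition stat_rate : R :=
  (variance_scale eps sigma * sigma `^ q / n%:R) `^ (1 / (q + 1)).

Let nR : 0 < n%:R :> R. Proof. by rewrite ltr0n. Qed.

Let s0 : 0 < sigma. Proof. exact: lt_trans ltr01 sigma1. Qed.

Let V0 : 0 < variance_scale eps sigma.
Proof. by have := @le_variance_scale _ eps sigma (ltW sigma1); exact: lt_le_trans. Qed.

Let q1 : q + 1 != 0. Proof. by rewrite gt_eqF // addr_gt0. Qed.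

Lemma stat_rate_gt0 : 0 < stat_rate.
Proof. by rewrite powR_gt0 // divr_gt0 // mulr_gt0 // powR_gt0. Qed.

Lemma Psi_stat_rate : Psi n eps q sigma = sigma `^ (- eps) + stat_rate.
Proof.
rewrite /Psi /stat_rate /variance_scale; case: ifPn => _; congr (_ + _).
  have -> : sigma * sigma `^ q = sigma `^ (q + 1).
    by rewrite powRD ?(gt_eqF s0) ?implybT // powRr1 ?(ltW s0) // mulrC.
  rewrite powRM ?powR_ge0 ?invr_ge0 // -powRrM.
  have -> : (q + 1) * (1 / (q + 1)) = 1 by field.
  rewrite powRr1 ?(ltW s0) //; congr (_ * _).
  by rewrite -[in RHS]powR_inv1 // -powRrM mulN1r powRN.
congr ((_ / _) `^ _); rewrite [RHS]mulrC.
by apply: powRD; rewrite (gt_eqF s0) implybT.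
Qed.

(** The rate solves rate^(q + 1) = V sigma^q / n, with V the variance scale. Equivalently, at radius
    rate / sigma the entropy cost equals the rate. *)
Lemma stat_rate_balance :
  variance_scale eps sigma / n%:R * (stat_rate / sigma) `^ (- q) = stat_rate.
Proof.
have g0 := stat_rate_gt0.
have gq : stat_rate `^ (q + 1) = variance_scale eps sigma * sigma `^ q / n%:R.
  rewrite /stat_rate -powRrM.
  have -> : 1 / (q + 1) * (q + 1) = 1 by field.
  by rewrite powRr1 // ?divr_ge0 ?mulr_ge0 ?powR_ge0 ?(ltW V0).
rewrite powRM ?invr_ge0 ?(ltW g0) ?(ltW s0) //.
rewrite -[sigma^-1]powR_inv1 ?(ltW s0) // -powRrM mulrN mulN1r opprK.
transitivity (stat_rate `^ (q + 1) * stat_rate `^ (- q)); first by rewrite gq; ring.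
rewrite -powRD; last by rewrite (gt_eqF g0) implybT.
by rewrite addrAC subrr add0r powRr1 // ltW.
Qed.

(** When the radius rate / sigma is at most 1, its power -q is at least 1, and the balance equation
    gives the bound. *)
Lemma variance_scale_le_rate : stat_rate <= sigma ->
  variance_scale eps sigma / n%:R <= stat_rate.
Proof.
move=> gs; rewrite -[leRHS]stat_rate_balance ler_peMr ?divr_ge0 ?(ltW V0) //.
rewrite -[leLHS](powRr0 (stat_rate / sigma)).
apply: ger_powR; last by rewrite oppr_le0 ltW.
by rewrite divr_gt0 ?stat_rate_gt0 // ler_pdivrMr // mul1r.
Qed.

End Rate.

(** * Extension by zero and deterministic oracle inequalities *)

Lemma restrict_bounded (T : Type) (R : realType) (X : set T) (f : T -> R) (M : R) x :
  0 <= M -> (forall y, X y -> `|f y| <= M) -> `|(f \_ X) x| <= M.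
Proof.
move=> M0 fM; rewrite patchE; case: ifPn => [/set_mem|_]; first exact: fM.
by rewrite normr0.
Qed.

Lemma L2sq_sqdist (R : realType) (d : nat) (X : set 'rV[R]_d)
    (rho : probability (Rd R d * R)%type R) (f g : 'rV[R]_d -> R) (M : R) :
  measurable_fun [set: Rd R d] (f \_ X : Rd R d -> R) ->
  measurable_fun [set: Rd R d] (g \_ X : Rd R d -> R) ->
  (forall x, `|(f \_ X) x| <= M) -> (forall x, `|(g \_ X) x| <= M) ->
  L2sq X rho (f \- g) = (sqdist rho (f \_ X : Rd R d -> R) (g \_ X : Rd R d -> R))%:E.
Proof.
move=> mf mg fM gM; rewrite /sqdist /Rintegral fineK; last first.
  by apply: integrable_fin_num => //; exact: (integrable_sqdist rho mf fM mg gM).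
rewrite /L2sq [LHS]integral_mkcond; apply: eq_integral => z _.
rewrite !patchE /= in_setX in_setT andbT.
by case: ifPn => // _; rewrite subr0 expr0n.
Qed.

Lemma probability_setI_full d (T : measurableType d) (R : realType)
    (P : probability T R) (A B : set T) :
  measurable A -> measurable B -> P B = 1%E -> (P A <= P (A `&` B))%E.
Proof.
move=> mA mB PB.
have PB0 : P (~` B) = 0%E by rewrite probability_setC // PB subee.
apply: le_trans (_ : P ((A `&` B) `|` ~` B) <= _)%E.
  apply: le_measure; rewrite ?inE //.
    by apply: measurableU; [exact: measurableI | exact: measurableC].
  by move=> x Ax; have [Bx|nBx] := pselect (B x); [left | right].
apply: le_trans (measureU2 _ _ _) _.
- exact: measurableI.
- exact: measurableC.
- by rewrite [X in (_ + X <= _)%E]PB0 adde0.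
Qed.

(** Here x is the entropy factor eta^-q, gam the rate, s = ln (N / delta) and L = ln (2 / delta).
    Multiplying by 16 (1 + M) V / n frees the risks from the tilt factor and turns s into at most a
    multiple of (c + L) gam. *)
Lemma deviation_oracle (R : realType) (M V n gam s L c x B Df Dh : R) :
  0 <= M -> 0 < V -> 0 < n ->
  V / n * x = gam -> V / n <= gam -> 0 <= L -> s <= c * x + L ->
  - ((16 * (1 + M) * V)^-1 * (n * (2 * gam))) <
  n * ((16 * (1 + M) * V)^-1 * (- Df / 2 + 3 / 2 * Dh + B)) + s ->
  Df <= 3 * Dh + 2 * B + 4 * gam + 32 * (1 + M) * ((c + L) * gam).
Proof.
move=> M0 V0 n0 xE Vn L0 sL H.
have k0 : 0 < 16 * (1 + M) * V by rewrite !mulr_gt0 //; lra.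
have : 0 < 2 * gam + (- Df / 2 + 3 / 2 * Dh + B) + s * (16 * (1 + M) * V) / n.
  have -> : 2 * gam + (- Df / 2 + 3 / 2 * Dh + B) + s * (16 * (1 + M) * V) / n =
    (16 * (1 + M) * V) / n * (n * ((16 * (1 + M) * V)^-1 * (- Df / 2 + 3 / 2 * Dh + B)) + s
      + (16 * (1 + M) * V)^-1 * (n * (2 * gam))).
    by field; rewrite !gt_eqF //=; lra.
  by rewrite mulr_gt0 ?divr_gt0 //; lra.
have : s * (16 * (1 + M) * V) / n <= 16 * (1 + M) * ((c + L) * gam).
  have -> : s * (16 * (1 + M) * V) / n = 16 * (1 + M) * (V / n * s) by ring.
  rewrite ler_wpM2l //; first by rewrite mulr_ge0 //; lra.
  apply: le_trans (_ : V / n * (c * x + L) <= _).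
    by rewrite ler_wpM2l // divr_ge0 // ltW.
  have -> : V / n * (c * x + L) = c * (V / n * x) + V / n * L by ring.
  by rewrite xE mulrDl lerD2l mulrC ler_wpM2l.
lra.
Qed.


Lemma emp_risk_gap (R : realType) (d n : nat) (X : set 'rV[R]_d) (sigma eta : R)
    (z : 'I_n -> (Rd R d * R)%type) (f1 f2 : 'rV[R]_d -> R) :
  0 <= sigma -> (forall i, X (z i).1) -> (forall x, X x -> `|f1 x - f2 x| <= eta) ->
  \sum_(i < n) huber sigma ((z i).2 - f2 (z i).1) <=
  \sum_(i < n) huber sigma ((z i).2 - f1 (z i).1) + n%:R * (2 * (sigma * eta)).
Proof.
move=> s0 Xz f12.
have -> : n%:R * (2 * (sigma * eta)) = \sum_(i < n) 2 * (sigma * eta).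
  by rewrite sumr_const card_ord mulr_natl.
rewrite -big_split /=; apply: ler_sum => i _.
set a := (z i).2 - f2 _; set b := (z i).2 - f1 _.
(* Any common bound on the residuals serves as w, since only the Lipschitz constant 2 sigma is
   retained. *)
have := huber_lipschitz (w := `|a| + `|b|) s0 (a := a) (b := b).
rewrite lerDl lerDr !normr_ge0 => /(_ isT isT) ab.
have ab2 : `|a - b| <= eta by rewrite (_ : a - b = f1 (z i).1 - f2 (z i).1);
  [exact: f12 | rewrite /a /b; ring].
have : `|huber sigma a - huber sigma b| <= 2 * (sigma * eta).
  apply: le_trans ab _; rewrite -mulrA ler_wpM2l // ler_pM //.
    by rewrite le_min s0 addr_ge0.
  by rewrite ge_min lexx.
by move=> h; have := le_trans (ler_norm _) h; lra.
Qed.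

(** * Moments of the response *)

Lemma powRD_le (R : realType) (a b p : R) : 0 <= a -> 0 <= b -> 0 <= p ->
  (a + b) `^ p <= 2 `^ p * (a `^ p + b `^ p).
Proof.
move=> a0 b0 p0; have pa := powR_ge0 a p; have pb := powR_ge0 b p.
have [ab|ba] := leP a b.
  apply: le_trans (_ : (2 * b) `^ p <= _).
    by apply: ge0_ler_powR; rewrite ?nnegrE //; lra.
  by rewrite powRM // ler_wpM2l ?powR_ge0 // lerDr.
apply: le_trans (_ : (2 * a) `^ p <= _).
  by apply: ge0_ler_powR; rewrite ?nnegrE //; lra.
by rewrite powRM // ler_wpM2l ?powR_ge0 // lerDl.
Qed.

Section Moments.
Context d (T : measurableType d) (R : realType) (mu : probability (T * R)%type R).
Variable eps : R.
Hypothesis eps0 : 0 < eps.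
Hypothesis moment : (\int[mu]_z ((`|z.2| `^ (1 + eps))%:E) < +oo)%E.

Let measurable_snd_powR (M : R) :
  measurable_fun setT (fun z : T * R => (`|z.2| + M) `^ (1 + eps)).
Proof.
apply: (measurableT_comp (measurable_powR (1 + eps))).
apply: measurable_funD => //.
by apply: measurableT_comp; [exact: normr_measurable | exact: measurable_snd].
Qed.

Lemma integrable_snd_powR :
  mu.-integrable setT (EFin \o (fun z : T * R => `|z.2| `^ (1 + eps))).
Proof.
apply/integrableP; split.
  apply/measurable_EFinP; have := measurable_snd_powR 0.
  by under eq_fun do rewrite addr0.
apply: le_lt_trans moment; rewrite le_eqVlt; apply/orP; left; apply/eqP.
by apply: eq_integral => z _ /=; rewrite ger0_norm // powR_ge0.
Qed.

Lemma integrable_shifted_snd_powR (M : R) : 0 <= M ->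
  mu.-integrable setT (EFin \o (fun z : T * R => (`|z.2| + M) `^ (1 + eps))).
Proof.
move=> M0.
have ip := integrableZl_EFin (2 `^ (1 + eps)) measurableT integrable_snd_powR.
have ic : mu.-integrable setT (EFin \o (fun=> 2 `^ (1 + eps) * M `^ (1 + eps))).
  exact: finite_measure_integrable_cst.
have is_ := integrableD_EFin measurableT ip ic.
apply: (le_integrable measurableT _ _ is_).
  by apply/measurable_EFinP; exact: measurable_snd_powR.
move=> z _ /=; rewrite lee_fin [leLHS]ger0_norm ?powR_ge0 //.
rewrite [leRHS]ger0_norm ?addr_ge0 ?mulr_ge0 ?powR_ge0 //.
by rewrite -mulrDr powRD_le // addr_ge0 // ltW.
Qed.

Lemma integrable_snd : mu.-integrable setT (EFin \o (fun z : T * R => z.2)).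
Proof.
have ic : mu.-integrable setT (EFin \o (fun=> 1 : R)).
  exact: finite_measure_integrable_cst.
have is_ := integrableD_EFin measurableT integrable_snd_powR ic.
apply: (le_integrable measurableT _ _ is_).
  by apply/measurable_EFinP; exact: measurable_snd.
move=> z _ /=; rewrite lee_fin [leRHS]ger0_norm ?addr_ge0 ?powR_ge0 //.
have [z1|z1] := leP `|z.2| 1; first by have := powR_ge0 `|z.2| (1 + eps); lra.
apply: le_trans (_ : `|z.2| `^ (1 + eps) <= _); last by lra.
by apply: le1r_powR; have := ltW eps0; have := ltW z1; lra.
Qed.

End Moments.

(** The defining identity of [cond_exp] concerns fstar itself; its extension by zero differs from it
    only off X, a null set. *)
Lemma cond_exp_mean0 (R : realType) (d : nat) (X : set 'rV[R]_d)
    (rho : probability (Rd R d * R)%type R) (fstar : 'rV[R]_d -> R) (M : R) :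
  measurable (X : set (Rd R d)) -> rho ((X : set (Rd R d)) `*` [set: R]) = 1%E ->
  measurable_fun [set: Rd R d] (fstar : Rd R d -> R) ->
  (forall x, `|(fstar \_ X) x| <= M) ->
  cond_exp rho fstar ->
  rho.-integrable setT (EFin \o (fun z : Rd R d * R => z.2)) ->
  rho.-integrable setT (EFin \o (fun z : Rd R d * R => z.2 - (fstar \_ X) z.1)) /\
  forall A : set (Rd R d), measurable A ->
    \int[rho]_(z in A `*` [set: R]) (z.2 - (fstar \_ X) z.1) = 0.
Proof.
move=> mX rhoX mfs fsM ce iy.
have mr : measurable_fun [set: Rd R d] (fstar \_ X : Rd R d -> R).
  by apply/(measurable_restrictT _ mX); exact: measurable_funS mfs.
have mr1 : measurable_fun setT (fun z : Rd R d * R => (fstar \_ X) z.1).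
  exact: (measurableT_comp mr measurable_fst).
have ir : rho.-integrable setT (EFin \o (fun z : Rd R d * R => (fstar \_ X) z.1)).
  by apply: (@integrable_bounded _ _ _ _ _ _ M).
split; first exact: (integrableB measurableT iy ir).
move=> A mA.
have mAR : measurable (A `*` [set: R]) by exact: measurableX.
have iyA : rho.-integrable (A `*` [set: R]) (EFin \o (fun z : Rd R d * R => z.2)).
  exact: integrableS iy.
have irA : rho.-integrable (A `*` [set: R])
    (EFin \o (fun z : Rd R d * R => (fstar \_ X) z.1)).
  exact: integrableS ir.
rewrite RintegralB //; apply/eqP; rewrite subr_eq0; apply/eqP.
rewrite /Rintegral ce //; congr fine; apply: ae_eq_integral => //.
- apply/measurable_EFinP; apply: measurable_funS (_ : measurable_fun setT _) => //.
  exact: (measurableT_comp mfs measurable_fst).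
- by apply/measurable_EFinP; exact: measurable_funS mr1.
have mXR : measurable ((X : set (Rd R d)) `*` [set: R]) by exact: measurableX.
exists (~` ((X : set (Rd R d)) `*` [set: R])); split.
- exact: measurableC.
- by rewrite [LHS](probability_setC rho mXR) rhoX subee.
- move=> z /= nz; apply: contra_not nz => -[Xz _] _.
  by rewrite patchE mem_set.
Qed.

(** * The constant and the oracle bound *)

(** Free of n, delta and sigma. Terms that lack the factor ln (2 / delta) acquire it through ln (2 /
    delta) / ln 2 >= 1, whence the division by ln 2. *)
Definition oracle_constant (R : realType) (M K c : R) : R :=
  6 + (4 * K + 10 + 64 * (1 + M) * c + 4 * M ^+ 2) / ln 2 + 64 * (1 + M).

Lemma oracle_constant_bound (R : realType) (M K c L b gam Dh Df : R) :
  0 <= M -> 0 <= K -> 0 < c -> ln 2 <= L -> 0 <= b -> 0 <= gam -> 0 <= Dh ->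
  Df <= 6 * Dh + 4 * (K * b) + 10 * gam + 64 * (1 + M) * ((c + L) * gam)
    \/ (1 <= gam /\ Df <= 4 * M ^+ 2) ->
  Df <= oracle_constant M K c * (Dh + L * (b + gam)).
Proof.
move=> M0 K0 c0 L2 b0 g0 D0.
have l2 : 0 < ln 2 :> R by rewrite ln_gt0 // ltr1n.
set l := ln 2 in L2 l2.
have L1 : 1 <= L / l by rewrite ler_pdivlMr // mul1r.
have L0 : 0 <= L by lra.
have num0 : 0 <= 4 * K + 10 + 64 * (1 + M) * c + 4 * M ^+ 2.
  by have := sqr_ge0 M; have := mulr_ge0 M0 (ltW c0); lra.
set num := _ + 4 * M ^+ 2 in num0.
have CE : oracle_constant M K c * (Dh + L * (b + gam)) =
    6 * Dh + num / l * Dh + 64 * (1 + M) * Dh + 6 * (L * (b + gam))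
    + num * (L / l) * (b + gam) + 64 * (1 + M) * (L * (b + gam)).
  by rewrite /oracle_constant -/num -/l; ring.
have nl : 0 <= num / l * Dh by rewrite !mulr_ge0 // invr_ge0 ltW.
have MD : 0 <= 64 * (1 + M) * Dh by rewrite !mulr_ge0 //; lra.
have Lb : 0 <= L * b by rewrite mulr_ge0.
have Lg : 0 <= L * gam by rewrite mulr_ge0.
have MLb : 0 <= M * (L * b) by rewrite mulr_ge0.
have MLg : 0 <= M * (L * gam) by rewrite mulr_ge0.
have main : num * (b + gam) <= num * (L / l) * (b + gam).
  by rewrite -mulrA ler_wpM2l // ler_peMl // addr_ge0.
have Kb := mulr_ge0 K0 b0; have Kg := mulr_ge0 K0 g0.
have M2b := mulr_ge0 (sqr_ge0 M) b0; have M2g := mulr_ge0 (sqr_ge0 M) g0.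
have Mcb := mulr_ge0 (mulr_ge0 M0 (ltW c0)) b0.
have Mcg := mulr_ge0 (mulr_ge0 M0 (ltW c0)) g0.
have cb := mulr_ge0 (ltW c0) b0; have cg := mulr_ge0 (ltW c0) g0.
rewrite CE => HD; apply: le_trans (_ : 6 * Dh + 6 * (L * (b + gam)) + num * (b + gam)
    + 64 * (1 + M) * (L * (b + gam)) <= _); last by lra.
rewrite /num; case: HD => [D|[g1 D]]; first by lra.
apply: (le_trans D); have : 4 * M ^+ 2 <= 4 * M ^+ 2 * gam.
  by rewrite ler_peMr // mulr_ge0 // sqr_ge0.
lra.
Qed.

Unset Implicit Arguments.
Set Strict Implicit.

Theorem theorem3 (R : realType) (d : nat) (X : set 'rV[R]_d) (Y : set R)
  (rho : probability (Rd R d * R)%type R) (fstar : 'rV[R]_d -> R)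
  (H : set ('rV[R]_d -> R)) (eps q c : R) :
  (* X compact, Y subset of R, rho a probability on X x Y *)
  compact X -> measurable Y -> rho ((X : set (Rd R d)) `*` Y) = 1%E ->
  (* fstar(x) = E(Y | X = x), bounded *)
  measurable_fun [set: Rd R d] (fstar : Rd R d -> R) ->
  cond_exp rho fstar ->
  (exists B : R, forall x, X x -> `|fstar x| <= B) ->
  (* H compact, uniformly bounded subset of C(X) *)
  (forall f, H f -> {within X, continuous f}) ->
  compact (H : set {uniform` X -> R}) ->
  (exists B : R, forall f x, H f -> X x -> `|f x| <= B) ->
  (* (i) moment condition *)
  0 < eps ->
  (\int[rho]_z ((`|z.2| `^ (1 + eps))%:E) < +oo)%E ->
  (* (ii) entropy condition *)
  0 < q -> 0 < c ->
  (forall eta : R, 0 < eta -> ln (covering_number X H eta)%:R <= c * eta `^ (- q)) ->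
  let M := Num.max (supnormX X fstar) (sup [set supnormX X f | f in H]) in
  exists C : R, 0 < C /\
  forall (sigma : R) (n : nat) (delta : R),
    Num.max (2 * M) 1 < sigma -> (0 < n)%N -> 0 < delta < 1 ->
    forall (dO : measure_display) (Omega : measurableType dO)
           (P : probability Omega R) (Z : 'I_n -> Omega -> (Rd R d * R)%type),
    iid_sample rho P Z ->
    forall fH : 'rV[R]_d -> R, H fH ->
      (forall g, H g -> (L2sq X rho (fH \- fstar)%R <= L2sq X rho (g \- fstar)%R)%E) ->
    exists E : set Omega, measurable E /\ (P E >= (1 - delta)%:E)%E /\
      forall w, E w ->
      forall fz : 'rV[R]_d -> R, H fz ->
        (forall g, H g -> emp_risk sigma (fun i => Z i w) fz <= emp_risk sigma (fun i => Z i w) g) ->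
        (L2sq X rho (fz \- fstar)%R <=
           C%:E * (L2sq X rho (fH \- fstar)%R + (ln (2 / delta) * Psi n eps q sigma)%:E))%E.
Proof.
move=> cX mY rhoXY mfs ce [Bs fsB] Hc cH [B HB] eps0 moment q0 c0 ent M.
have mX := compact_measurable_Rd cX.
have mXR : measurable ((X : set (Rd R d)) `*` [set: R]) by exact: measurableX.
have rhoX : rho ((X : set (Rd R d)) `*` [set: R]) = 1%E.
  apply/eqP; rewrite eq_le probability_le1 //= -rhoXY.
  by apply: le_measure; rewrite ?inE //; [exact: measurableX | move=> z [? _]; split].
have [x0 Xx0] : exists x, X x.
  apply/set0P/eqP => X0; move: rhoX; rewrite X0 set0X measure0 => /eqP.
  by rewrite eqe eq_sym oner_eq0.
have fsM x : X x -> `|fstar x| <= M.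
  by move=> Xx; rewrite le_max (supnormX_ge fsB Xx).
have HM f x : H f -> X x -> `|f x| <= M.
  move=> Hf Xx; rewrite le_max; apply/orP; right.
  apply: le_trans (supnormX_ge (fun y => HB f y Hf) Xx) _.
  apply: ub_le_sup; last by exists f.
  exists B => _ [g Hg <-]; apply: ge_sup; first by exists `|g x|, x.
  by move=> _ [y Xy <-]; exact: HB.
have M0 : 0 <= M by apply: le_trans (fsM _ Xx0).
(* The bounds hold only on X, so every function is extended by zero before the risk bounds are
   applied. *)
pose g : Rd R d -> R := fstar \_ X.
have mg : measurable_fun setT g.
  by apply/(measurable_restrictT _ mX); exact: measurable_funS mfs.
have gM x : `|g x| <= M by exact: restrict_bounded.
have mH f : H f -> measurable_fun [set: Rd R d] (f \_ X : Rd R d -> R).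
  by move=> Hf; apply: restrict_measurable_Rd => //; exact: Hc.
have HrM f x : H f -> `|(f \_ X) x| <= M.
  by move=> Hf; apply: restrict_bounded => // y; exact: HM.
have mW := integrable_shifted_snd_powR eps0 moment M0.
have [ires mean0] := cond_exp_mean0 mX rhoX mfs gM ce (integrable_snd eps0 moment).
set m := \int[rho]_z (`|z.2| + M) `^ (1 + eps).
have m0 : 0 <= m by apply: Rintegral_ge0 => z _; exact: powR_ge0.
pose K := (8 * M * 2 `^ eps + M) * m.
have K0 : 0 <= K by rewrite mulr_ge0 // addr_ge0 // !mulr_ge0 // powR_ge0.
have l2 : 0 < ln 2 :> R by rewrite ln_gt0 // ltr1n.
exists (oracle_constant M K c); split.
  have := sqr_ge0 M; have := mulr_ge0 M0 (ltW c0) => Mc M2.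
  rewrite /oracle_constant; have : 0 <= (4 * K + 10 + 64 * (1 + M) * c + 4 * M ^+ 2) / ln 2.
    by rewrite divr_ge0 ?(ltW l2) //; lra.
  lra.
move=> sigma n delta; rewrite gt_max => /andP[sM s1] n0 /andP[d0 d1].
move=> dO Omega P Z [mZ [lawZ indepZ]] fH HfH fHmin.
have s0 : 0 < sigma by exact: lt_trans s1.
have mh := mH _ HfH; have hM x := HrM _ x HfH.
pose h : Rd R d -> R := fH \_ X.
have Dh : L2sq X rho (fH \- fstar) = (sqdist rho h g)%:E by exact: L2sq_sqdist.
have Dh0 : 0 <= sqdist rho h g by apply: Rintegral_ge0 => z _; exact: sqr_ge0.
have L2 : ln 2 <= ln (2 / delta) :> R.
  by rewrite ler_ln ?posrE ?divr_gt0 // ler_pdivlMr //; lra.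
set gam := stat_rate eps q sigma n.
have gam0 : 0 < gam by exact: stat_rate_gt0.
have conclude (fz : 'rV[R]_d -> R) : H fz ->
    sqdist rho (fz \_ X : Rd R d -> R) g <= 6 * sqdist rho h g
      + 4 * (K * sigma `^ (- eps)) + 10 * gam
      + 64 * (1 + M) * ((c + ln (2 / delta)) * gam) \/
    (1 <= gam /\ sqdist rho (fz \_ X : Rd R d -> R) g <= 4 * M ^+ 2) ->
    (L2sq X rho (fz \- fstar)%R <= (oracle_constant M K c)%:E *
      (L2sq X rho (fH \- fstar)%R + (ln (2 / delta) * Psi n eps q sigma)%:E))%E.
  move=> Hfz HD; have Df : L2sq X rho (fz \- fstar) = (sqdist rho (fz \_ X : Rd R d -> R) g)%:E.
    by apply: (@L2sq_sqdist _ _ _ _ _ _ M) => //; [exact: mH | move=> x; exact: HrM].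
  rewrite Dh Df -EFinD -EFinM lee_fin Psi_stat_rate //.
  by apply: oracle_constant_bound => //; rewrite ?powR_ge0 // ltW.
(* If the rate exceeds sigma it exceeds 1, and the trivial bound 4 M^2 suffices on the whole sample
   space. *)
have [gs|sg] := leP gam sigma; last first.
  exists setT; split=> //; split.
    by rewrite probability_setT lee_fin gerBl ltW.
  move=> w _ fz Hfz _; apply: conclude => //; right; split; first exact: le_trans (ltW s1) (ltW sg).
  by apply: (sqdist_le rho (mH _ Hfz) _ mg gM) => x; exact: HrM.
pose eta := gam / sigma.
have eta0 : 0 < eta by rewrite divr_gt0.
have [fs [Hfs cov]] := covering_numberP cH eta0 HB.
set N := covering_number X H eta in fs Hfs cov.
(* The net is nonempty because it has a point close to [fH]. *)
have N0 : (0 < N)%N by have [i _] := cov _ HfH; apply: leq_ltn_trans (ltn_ord i).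
have NR : 0 < N%:R :> R by rewrite ltr0n.
have [E0 [mE0 [PE0 dev]]] := uniform_tilt_deviation eps0 sM s1 mg gM mh hM mW ires mean0
  mZ lawZ indepZ N0 d0 (fun j => mH _ (Hfs j)) (fun j x => HrM _ x (Hfs j)).
(* The net approximates only on X, so the sample must lie in X; this has probability one. *)
pose F := \bigcap_(i in [set: 'I_n]) (Z i @^-1` ((X : set (Rd R d)) `*` [set: R])).
have mF : measurable F.
  apply: fin_bigcap_measurable => // i _.
  by rewrite -[_ @^-1` _]setTI; exact: mZ.
have PF : P F = 1%E.
  rewrite -[LHS]fineK ?fin_num_measure // indepZ //.
  by rewrite big1 // => i _; rewrite lawZ // rhoX.
exists (E0 `&` F); split; first exact: measurableI.
split; first by apply: le_trans PE0 _; exact: probability_setI_full.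
move=> w [E0w Fw] fz Hfz fzmin; apply: conclude => //; left.
have XZ i : X (Z i w).1 by have [] := Fw i I.
have [j fzj] := cov _ Hfz.
have sN : ln (N%:R / delta) <= c * eta `^ (- q) + ln (2 / delta).
  rewrite ln_div ?posrE // [ln (2 / delta)]ln_div ?posrE //.
  by have := ent _ eta0; rewrite -/N; lra.
pose f : Rd R d -> R := fs j \_ X.
have scale0 : 0 < (16 * (1 + M) * variance_scale eps sigma)^-1.
  rewrite invr_gt0 !mulr_gt0 ?ltr_wpDr //.
  by apply: lt_le_trans s0 _; apply: le_variance_scale; exact: ltW.
(* The minimizer [fz] has empirical loss at most that of [fH], and moving to its net point adds at
   most 2 sigma eta = 2 gam per observation. *)
have tilt_lower : - ((16 * (1 + M) * variance_scale eps sigma)^-1 * (n%:R * (2 * gam)))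
    <= \sum_(i < n) tilt_loss eps sigma M h f (Z i w).
  have -> : \sum_(i < n) tilt_loss eps sigma M h f (Z i w) =
      (16 * (1 + M) * variance_scale eps sigma)^-1 *
      (\sum_(i < n) huber sigma ((Z i w).2 - fH (Z i w).1)
       - \sum_(i < n) huber sigma ((Z i w).2 - fs j (Z i w).1)).
    rewrite -sumrB mulr_sumr; apply: eq_bigr => i _.
    by rewrite /tilt_loss /tilt /h /f !patchE !mem_set.
  rewrite -mulrN ler_pM2l //.
  have gap := emp_risk_gap (ltW s0) XZ fzj.
  have := fzmin _ HfH; rewrite /emp_risk ler_pM2l ?invr_gt0 ?ltr0n // => fzH.
  by move: gap; rewrite /eta [sigma * _]mulrC divfK ?gt_eqF //; lra.
have V0 : 0 < variance_scale eps sigma.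
  by apply: lt_le_trans s0 _; apply: le_variance_scale; exact: ltW.
have nR : 0 < n%:R :> R by rewrite ltr0n.
have L0 : 0 <= ln (2 / delta) by exact: le_trans (ltW l2) L2.
have Dj := deviation_oracle M0 V0 nR (stat_rate_balance eps q0 s1 n0)
  (variance_scale_le_rate q0 s1 n0 gs) L0 sN (le_lt_trans tilt_lower (dev _ E0w j)).
have Dz : sqdist rho (fz \_ X : Rd R d -> R) g <= 2 * sqdist rho f g + 2 * eta ^+ 2.
  apply: (@sqdist_triangle _ _ _ _ M) => //.
  - exact: mH.
  - by move=> x; exact: HrM.
  - exact: mH.
  - by move=> x; exact: HrM.
  - move=> x; rewrite /f !patchE; case: ifPn => [/set_mem /fzj //|_].
    by rewrite subrr normr0 ltW.
(* Since gam <= sigma and sigma > 1, eta is at most 1 and at most gam. *)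
have eta2 : eta ^+ 2 <= gam.
  have e1 : eta <= 1 by rewrite ler_pdivrMr // mul1r.
  have eg : eta <= gam by rewrite ler_pdivrMr // ler_peMr // ltW.
  by apply: le_trans eg; rewrite expr2 ler_piMl // ltW.
have biasE : tilt_bias rho eps sigma M = K * sigma `^ (- eps).
  by rewrite /tilt_bias /K -/m; ring.
move: Dj; rewrite biasE -/gam -/f -/g -/h => Dj.
(* Twice the bound at the net point plus 2 eta^2 <= 2 gam; this is the source of 6, 4, 10 = 2 * 4 +
   2 and 64. *)
lra.
Qed.
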